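(* Let $K\ge2$, let $\mathbf{p}$ be a probability vector on $[K]$ with all $p_k>0$, let $\mathbf{W}$ be a $K\times K$ invertible row-stochastic matrix, and let $\hat{\mathbf{p}}_n=\mathrm{Proj}_{\mathbb{P}}(\check{\mathbf{p}}_n)$ be an estimator as described in the context. Then $$\mathbb{E}\big[\Vert\hat{\mathbf{p}}_n-\mathbf{p}\Vert_1\big]=\sqrt{\frac{2}{\pi n}}\sum_{k=1}^K\sqrt{\nu_{2,k}-\nu_{1,k}^2}+o\Big(\frac1{\sqrt n}\Big)\quad(n\to\infty).$$
   Context: Setting: $X_1,\dots,X_n$ i.i.d. with law $\mathbf{p}$; each $X_i$ passed independently through $\mathbf{W}$ ($\Pr\{Y_i=\ell\mid X_i=k\}=W_{k,\ell}$), giving $\mathbf{y}_n$. $\mathbf{t}(\mathbf{y}_n)$ is the empirical distribution of $\mathbf{y}_n$, $\check{\mathbf{p}}_n=\mathbf{t}(\mathbf{y}_n)\mathbf{W}^{-1}$, $\mathbb{P}$ is the probability simplex, and $\mathrm{Proj}_{\mathbb{P}}$ is any fixed map from vectors with entries summing to one into $\mathbb{P}$ with $\mathrm{Proj}_{\mathbb{P}}(\mathbf{v})=\mathbf{v}$ for $\mathbf{v}\in\mathbb{P}$. $\nu_{\rho,k}=\mathbf{p}\mathbf{W}(\mathbf{W}^{-1}\odot\cdots\odot\mathbf{W}^{-1})\mathbf{e}_k^\top$ ($\rho$ Hadamard factors); $\nu_{1,k}=p_k$. *)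

(* Defs.v *)
From HB Require Import structures.
From mathcomp Require Import all_boot all_order all_algebra.
From mathcomp Require Import all_classical all_reals all_analysis.
Set Implicit Arguments. Unset Strict Implicit. Unset Printing Implicit Defensive.
Import Order.TTheory GRing.Theory Num.Theory.
Local Open Scope ring_scope.

Section Defs.
Variable R : realType.
Variable K : nat.

Definition prob_vec (v : 'rV[R]_K) : Prop :=
  (forall k, 0 <= v 0 k) /\ \sum_k v 0 k = 1.

Definition row_stochastic (W : 'M[R]_K) : Prop :=
  (forall k l, 0 <= W k l) /\ (forall k, \sum_l W k l = 1).

Definition emp_dist (n : nat) (y : {ffun 'I_n -> 'I_K}) : 'rV[R]_K :=
  \row_l ((#|[set i | y i == l]|)%:R / n%:R).

Definition check_p (W : 'M[R]_K) (n : nat) (y : {ffun 'I_n -> 'I_K}) : 'rV[R]_K :=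
  emp_dist y *m invmx W.

Definition hadamard_pow (rho : nat) (A : 'M[R]_K) : 'M[R]_K :=
  \matrix_(i, j) (A i j ^+ rho).

Definition nu (rho : nat) (p : 'rV[R]_K) (W : 'M[R]_K) (k : 'I_K) : R :=
  (p *m W *m hadamard_pow rho (invmx W)) 0 k.

Definition l1norm (v : 'rV[R]_K) : R := \sum_k `|v 0 k|.

(* E[ f(y_n) ] where X_i iid ~ p and Y_i | X_i = k ~ W_{k,.}, independently *)
Definition expect_y (p : 'rV[R]_K) (W : 'M[R]_K) (n : nat)
  (f : {ffun 'I_n -> 'I_K} -> R) : R :=
  \sum_(x : {ffun 'I_n -> 'I_K}) \sum_(y : {ffun 'I_n -> 'I_K})
     (\prod_(i < n) (p 0 (x i) * W (x i) (y i))) * f y.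

End Defs.

(* Main.v *)
Require Import Defs.
From HB Require Import structures.
From mathcomp Require Import all_boot all_order all_algebra.
From mathcomp Require Import all_classical all_reals all_analysis.
From mathcomp Require Import ring lra zify.
Import Order.TTheory GRing.Theory Num.Theory.
Import numFieldNormedType.Exports.
Local Open Scope classical_set_scope.
Local Open Scope ring_scope.

(** Each coordinate of [check_p W y - p] is [1/n] times a sum [S_n] of [n]
    i.i.d. bounded centred variables of variance [nu_2 - nu_1^2], so everything
    reduces to [E|S_n| / sqrt n --> sqrt (2 / pi) * sigma].  Lindeberg's
    replacement argument, applied to the smoothing [sqrt (x^2 + D^2)] of [|x|]
    with [D] of order [n^(3/8)], compares [S_n] with [sigma] times the simple
    random walk.  For that walk, [E|S_(n+1)| = E|S_n| + P(S_n = 0)] and a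
    discrete Stein identity express [E|S_n|] through the return probabilities,
    which are Wallis integrals up to the factor [2 / pi].  The projection acts
    only when some coordinate deviates by at least [p_k]; by Chebyshev this
    costs [O(1/n)]. *)

Set Implicit Arguments.
Unset Strict Implicit.

(** * Averaging operators and the Lindeberg comparison *)

Section averaging.
Variable R : realType.

(** One random step as an operator on functions: its [n]-th iterate at [x] is the expectation of [f]
    at [x] plus [n] independent steps. Independence becomes commutation of operators. *)
Definition avg (V : zmodType) (I : finType) (q : I -> R) (a : I -> V)
    (f : V -> R) (x : V) : R :=
  \sum_i q i * f (x + a i).

Definition coin (V : zmodType) (s : V) : (V -> R) -> V -> R :=
  avg (fun=> 2^-1) (fun b => if b then s else - s).

Lemma coinE (V : zmodType) (s : V) (f : V -> R) (x : V) :
  coin s f x = (f (x + s) + f (x - s)) / 2.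
Proof. by rewrite /coin /avg big_bool /=; ring. Qed.

Lemma avg_comm (V : zmodType) (I J : finType) (q : I -> R) (a : I -> V)
    (r : J -> R) (b : J -> V) (f : V -> R) :
  avg q a (avg r b f) = avg r b (avg q a f).
Proof.
apply: funext => x; rewrite /avg.
under eq_bigr do rewrite mulr_sumr.
rewrite exchange_big; apply: eq_bigr => j _; rewrite mulr_sumr.
by apply: eq_bigr => i _; rewrite mulrCA addrAC.
Qed.

Lemma iter_comm (T : Type) (F G : T -> T) n (x : T) :
  (forall y, F (G y) = G (F y)) -> F (iter n G x) = iter n G (F x).
Proof. by move=> FG; elim: n => //= n <-. Qed.

Section weights.
Variables (V : zmodType) (I : finType) (q : I -> R) (a : I -> V).
Hypotheses (q0 : forall i, 0 <= q i) (q1 : \sum_i q i = 1).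

Lemma avg_near (f h : V -> R) e :
  (forall x, `|f x - h x| <= e) ->
  forall x, `|avg q a f x - avg q a h x| <= e.
Proof.
move=> fh x; rewrite /avg -sumrB; apply: le_trans (ler_norm_sum _ _ _) _.
rewrite -[e]mul1r -q1 mulr_suml; apply: ler_sum => i _.
by rewrite -mulrBr normrM ger0_norm ?q0 // ler_wpM2l.
Qed.

Lemma iter_avg_near (f h : V -> R) e n :
  (forall x, `|f x - h x| <= e) ->
  forall x, `|iter n (avg q a) f x - iter n (avg q a) h x| <= e.
Proof. by move=> fh; elim: n => //= n IHn; exact: avg_near. Qed.

End weights.

(* The telescoping step works because averaging operators commute. *)
Lemma lindeberg (V : zmodType) (I J : finType) (q : I -> R) (a : I -> V)
    (r : J -> R) (b : J -> V) (f : V -> R) e n :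
  (forall i, 0 <= q i) -> \sum_i q i = 1 ->
  (forall j, 0 <= r j) -> \sum_j r j = 1 ->
  (forall x, `|avg q a f x - avg r b f x| <= e) ->
  forall x, `|iter n (avg q a) f x - iter n (avg r b) f x| <= n%:R * e.
Proof.
move=> q0 q1 r0 r1 fe; elim: n => [|n IHn] x; first by rewrite subrr normr0 mul0r.
rewrite !iterS -natr1 mulrDl mul1r.
set u := iter n _ f in IHn *; set v := iter n _ f in IHn *.
have -> : avg q a u x - avg r b v x =
   (avg q a u x - avg q a v x) + (avg q a v x - avg r b v x).
  by ring.
apply: le_trans (ler_normD _ _) _; apply: lerD; first exact: avg_near.
rewrite (iter_comm (F := avg q a)); last by move=> g; exact: avg_comm.
rewrite /v -iterS iterSr; exact: iter_avg_near.
Qed.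

(** With [s] the value at [x], the second derivative is [D^2 / s^3] and the third is of order
    [1 / D^2]: a larger [D] is smoother but farther from the absolute value. *)
Definition smooth_abs (D x : R) : R := Num.sqrt (x ^+ 2 + D ^+ 2).

Lemma smooth_abs_near (D x : R) : 0 <= D -> `| `|x| - smooth_abs D x| <= D.
Proof.
move=> D0; rewrite /smooth_abs.
have s0 := sqrtr_ge0 (x ^+ 2 + D ^+ 2).
have : Num.sqrt (x ^+ 2 + D ^+ 2) ^+ 2 = x ^+ 2 + D ^+ 2.
  by rewrite sqr_sqrtr // addr_ge0 ?sqr_ge0.
set s := Num.sqrt _ in s0 *; rewrite -(real_normK (num_real x)).
have := normr_ge0 x; move: `|x| => y y0 sE.
rewrite ler_norml; apply/andP; split; nra.
Qed.

(** Purely algebraic: the root [s'] and its quadratic Taylor polynomial [T] are compared through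
    [s'^2 - T^2], which is explicit and starts at order [t^3]; one then divides by [s' + T >= D]. *)
Lemma smooth_abs_taylor (D x t : R) : 0 < D -> `|t| <= D ->
  let s := smooth_abs D x in
  `|smooth_abs D (x + t) - (s + x / s * t + D ^+ 2 / (2 * s ^+ 3) * t ^+ 2)|
    <= 2 * `|t| ^+ 3 / D ^+ 2.
Proof.
move=> D0 tD /=; set s := smooth_abs D x; rewrite /smooth_abs.
set s' := Num.sqrt _; set T := (X in s' - X).
have sE : s ^+ 2 = x ^+ 2 + D ^+ 2 by rewrite sqr_sqrtr // addr_ge0 ?sqr_ge0.
have s'E : s' ^+ 2 = (x + t) ^+ 2 + D ^+ 2 by rewrite sqr_sqrtr // addr_ge0 ?sqr_ge0.
have s0 : 0 <= s := sqrtr_ge0 _.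
have s'0 : 0 <= s' := sqrtr_ge0 _.
have Ds : D <= s by rewrite -(@ler_pXn2r _ 2)// ?nnegrE ?(ltW D0)// sE lerDr sqr_ge0.
have Ds' : D <= s'.
  by rewrite -(@ler_pXn2r _ 2)// ?nnegrE ?(ltW D0)// s'E lerDr sqr_ge0.
have sp : 0 < s by lra.
have xs : `|x| <= s.
  rewrite -(@ler_pXn2r _ 2)// ?nnegrE ?normr_ge0// real_normK ?num_real// sE.
  by rewrite lerDl sqr_ge0.
have Dsn : s != 0 by rewrite gt_eqF.
(* Since [|t| <= D <= s], the term [s] absorbs the linear one, whose slope is at most 1 in absolute
   value. *)
have Tge : 0 <= T.
  have h1 : - `|t| <= x / s * t.
    have : `|x / s * t| <= `|t|.
      rewrite normrM ler_piMl ?normr_ge0// normrM normfV (ger0_norm s0).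
      by rewrite ler_pdivrMr// mul1r.
    by rewrite ler_norml => /andP[].
  have h2 : 0 <= D ^+ 2 / (2 * s ^+ 3) * t ^+ 2.
    by rewrite mulr_ge0 ?sqr_ge0// divr_ge0 ?sqr_ge0// mulr_ge0// exprn_ge0.
  rewrite /T; lra.
(* The orders 0, 1 and 2 in [t] cancel because [x^2 + D^2 = s^2]. *)
have key : (s' - T) * (s' + T) =
    - (x * D ^+ 2 * t ^+ 3 / s ^+ 4) - D ^+ 4 * t ^+ 4 / (4 * s ^+ 6).
  have -> : (s' - T) * (s' + T) = s' ^+ 2 - T ^+ 2 by ring.
  have D2 : D ^+ 2 = s ^+ 2 - x ^+ 2 by rewrite sE; ring.
  have D4 : D ^+ 4 = (D ^+ 2) ^+ 2 by ring.
  rewrite s'E /T D4 D2.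
  by field.
have : `|s' - T| * D <= 2 * `|t| ^+ 3 / D.
  apply: (@le_trans _ _ (`|s' - T| * (s' + T))).
    by rewrite ler_wpM2l ?normr_ge0//; lra.
  have sT0 : 0 <= s' + T by lra.
  rewrite -[X in _ * X <= _](ger0_norm sT0) -normrM key; apply: le_trans (ler_normB _ _) _.
  rewrite normrN !(normrX, normfV, normrM) (ger0_norm s0) (gtr0_norm D0).
  rewrite (ger0_norm (_ : 0 <= 4)) //.
  have iD : s^-1 <= D^-1 by rewrite lef_pV2.
  have i0 : 0 <= s^-1 by rewrite invr_ge0.
  have u0 := normr_ge0 t.
  (* Both remainders are regrouped as [|t|^3 / s] times ratios lying in [0, 1]. *)
  have -> : `|x| * D ^+ 2 * `|t| ^+ 3 / s ^+ 4 = (`|x| / s) * (D / s) ^+ 2 * `|t| ^+ 3 / s.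
    by field.
  have -> : D ^+ 4 * `|t| ^+ 4 / (4 * s ^+ 6) =
     (D / s) ^+ 4 * (`|t| / s) * `|t| ^+ 3 / s / 4 by field.
  have b1 : 0 <= `|x| / s <= 1.
    by rewrite divr_ge0 ?normr_ge0//= ler_pdivrMr// mul1r.
  have b2 : 0 <= D / s <= 1.
    by rewrite divr_ge0 ?(ltW D0)//= ler_pdivrMr// mul1r.
  have b3 : 0 <= `|t| / s <= 1.
    by rewrite divr_ge0 ?normr_ge0//= ler_pdivrMr// mul1r; lra.
  have c : 0 <= `|t| ^+ 3 / s <= `|t| ^+ 3 / D.
    by rewrite divr_ge0 ?exprn_ge0//= ler_wpM2l// exprn_ge0.
  have m1 : `|x| / s * (D / s) ^+ 2 <= 1.
    case/andP: b1 => ? ?; case/andP: b2 => ? ?.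
    by rewrite mulr_ile1 // ?exprn_ge0 ?exprn_ile1.
  have m2 : (D / s) ^+ 4 * (`|t| / s) <= 1.
    case/andP: b3 => ? ?; case/andP: b2 => ? ?.
    by rewrite mulr_ile1 // ?exprn_ge0 ?exprn_ile1.
  have -> : `|x| / s * (D / s) ^+ 2 * `|t| ^+ 3 / s =
     `|x| / s * (D / s) ^+ 2 * (`|t| ^+ 3 / s) by ring.
  have -> : (D / s) ^+ 4 * (`|t| / s) * `|t| ^+ 3 / s / 4=
     (D / s) ^+ 4 * (`|t| / s) * (`|t| ^+ 3 / s) / 4 by ring.
  rewrite -[2 * _ / D]mulrA; case/andP: c; move: m1 m2.
  set A := _ * _; set B := (D / s) ^+ 4 * _; set C := _ / s; set E := _ / D; nra.
rewrite -ler_pdivlMr// => /le_trans; apply.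
by rewrite le_eqVlt; apply/orP; left; apply/eqP; field; rewrite gt_eqF.
Qed.

(** Centring kills the linear term, so up to the cubic error a step enters only through its
    variance. *)
Lemma smooth_avg_taylor (I : finType) (q g : I -> R) (D M : R) :
  (forall i, 0 <= q i) -> \sum_i q i = 1 -> \sum_i q i * g i = 0 ->
  0 < D -> M <= D -> (forall i, `|g i| <= M) ->
  forall x, let s := smooth_abs D x in
  `|avg q g (smooth_abs D) x
     - (s + D ^+ 2 / (2 * s ^+ 3) * \sum_i q i * g i ^+ 2)| <= 2 * M ^+ 3 / D ^+ 2.
Proof.
move=> q0 q1 qg D0 MD gM x /=; set s := smooth_abs D x.
have -> : s + D ^+ 2 / (2 * s ^+ 3) * \sum_i q i * g i ^+ 2 =
   \sum_i q i * (s + x / s * g i + D ^+ 2 / (2 * s ^+ 3) * g i ^+ 2).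
  under [RHS]eq_bigr do rewrite !mulrDr.
  rewrite !big_split /= -mulr_suml q1 mul1r.
  under [X in _ = _ + X + _]eq_bigr do rewrite mulrCA.
  rewrite -mulr_sumr qg mulr0 addr0; congr (_ + _).
  by rewrite mulr_sumr; apply: eq_bigr => i _; rewrite mulrCA.
rewrite /avg -sumrB; apply: le_trans (ler_norm_sum _ _ _) _.
set e := leRHS; have -> : e = \sum_i q i * e by rewrite -mulr_suml q1 mul1r.
apply: ler_sum => i _; rewrite -mulrBr normrM ger0_norm ?q0 // ler_wpM2l//.
apply: le_trans (smooth_abs_taylor x D0 (le_trans (gM i) MD)) _.
rewrite ler_wpM2r ?invr_ge0 ?sqr_ge0// ler_wpM2l// lerXn2r ?nnegrE//.
exact: le_trans (gM i).
Qed.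

End averaging.

(** * Wallis integrals *)

Section wallis.
Variable R : realType.

(** An antiderivative of [sin ^+ n], defined by the reduction formula of integration by parts. *)
Fixpoint sin_primitive (n : nat) (x : R) : R :=
  match n with
  | 0 => x
  | 1 => - cos x
  | m.+2 => (m.+1%:R * sin_primitive m x - cos x * sin x ^+ m.+1) / m.+2%:R
  end.

(** The integral of [sin ^+ n] over [0, pi/2]. *)
Definition wallis (n : nat) : R := sin_primitive n (pi / 2) - sin_primitive n 0.

Lemma is_derive_sin_primitive n (x : R) :
  is_derive x 1 (sin_primitive n) (sin x ^+ n).
Proof.
elim/ltn_ind: n x => -[_ x|[_ x|n IH x]].
- by rewrite expr0; exact: is_derive_id.
- rewrite (_ : sin_primitive 1 = - cos); last by apply: funext => y.
  by apply: is_derive_eq; rewrite opprK expr1.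
have d := IH n (ltnW (ltnSn _)) x.
rewrite (_ : sin_primitive n.+2 =
  (fun y => (n.+2%:R^-1 *: (n.+1%:R *: sin_primitive n - cos * (sin ^+ n.+1))) y)); last first.
  by apply: funext => y; rewrite /= /GRing.scale /=; rewrite mulrC; congr (_ * (_ - _)); rewrite !fctE.
apply: is_derive_eq.
rewrite /GRing.scale /= fctE.
have -> : sin x ^+ n.+2 = sin x ^+ n * sin x ^+ 2 by rewrite -addn2 exprD.
have -> : cos x * (n.+1%:R * sin x ^+ n * cos x) = n.+1%:R * sin x ^+ n * cos x ^+ 2.
  by ring.
by rewrite cos2sin2 (exprS _ n); field; rewrite -natrD pnatr_eq0 addSn.
Qed.

Lemma wallis0 : wallis 0 = pi / 2.
Proof. by rewrite /wallis subr0. Qed.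

Lemma wallis1 : wallis 1 = 1.
Proof. by rewrite /wallis /= cos_pihalf cos0; ring. Qed.

(** The boundary term [cos * sin ^+ n.+1] vanishes at both ends. *)
Lemma wallisSS n : n.+2%:R * wallis n.+2 = n.+1%:R * wallis n.
Proof.
by rewrite /wallis /= cos_pihalf sin0 expr0n /=; field.
Qed.

(** On the interval [h] has derivative [sin^n (1 - sin) >= 0], hence is nondecreasing. *)
Lemma wallis_le n : wallis n.+1 <= wallis n.
Proof.
pose h (x : R) := sin_primitive n x - sin_primitive n.+1 x.
have dh (x : R) : is_derive x 1 h (sin x ^+ n - sin x ^+ n.+1).
  have ? := is_derive_sin_primitive n x; have ? := is_derive_sin_primitive n.+1 x.
  exact: is_deriveB.
suff : h 0 <= h (pi / 2) by rewrite /h /wallis; lra.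
have pi0 : 0 <= pi / 2 :> R by rewrite divr_ge0 ?pi_ge0.
apply: (@ger0_derive1_ndecr _ h 0 (pi / 2)) => [x _|x||//|//|//].
- by have [] := dh x.
- rewrite in_itv/= => x0; have dhx := dh x; rewrite derive1E derive_val exprS.
  have s0 := ltW (sin_gt0_pihalf x0); have s1 := sin_le1 x.
  by rewrite subr_ge0 ler_piMl// exprn_ge0.
- apply: continuous_subspaceT => x.
  by apply: differentiable_continuous; apply/derivable1_diffP; have [] := dh x.
Qed.

(** By the recurrence the left side does not depend on [n]. With monotonicity this encloses
    [wallis n ^+ 2] between [pi / (2 (n + 1))] and [pi / (2 n)]. *)
Lemma wallis_mul n : n.+1%:R * (wallis n * wallis n.+1) = pi / 2.
Proof.
elim: n => [|n IHn]; first by rewrite wallis0 wallis1; ring.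
rewrite -IHn; have := wallisSS n => e.
transitivity (wallis n.+1 * (n.+2%:R * wallis n.+2)); first by ring.
by rewrite e; ring.
Qed.

Lemma wallis_gt0 n : 0 < wallis n.
Proof.
elim/ltn_ind: n => -[_|[_|n IH]].
- by rewrite wallis0 divr_gt0 ?pi_gt0.
- by rewrite wallis1.
by rewrite -(pmulr_rgt0 _ (ltr0Sn R n.+1)) wallisSS mulr_gt0// IH.
Qed.

Lemma wallis_sqr_ge n : pi / 2 <= n.+1%:R * wallis n ^+ 2.
Proof.
rewrite -(wallis_mul n) expr2 !mulrA ler_wpM2l ?wallis_le//.
by rewrite mulr_ge0// ltW// wallis_gt0.
Qed.

Lemma wallis_sqr_le n : n%:R * wallis n ^+ 2 <= pi / 2.
Proof.
case: n => [|n]; first by rewrite mul0r divr_ge0 ?pi_ge0.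
rewrite -(wallis_mul n) expr2 ler_wpM2l// ler_wpM2r ?wallis_le//.
by rewrite ltW// wallis_gt0.
Qed.
End wallis.

(** * The simple random walk on the integers *)

Section rademacher.
Variable R : realType.

Local Notation B := (@coin R int 1).
(** For the walk [S_n] started at 0, these are [E|S_n|] and [P(S_n = 0)]. *)
Definition walk_abs (n : nat) : R := iter n B (fun z => `|z|%:~R) 0.
Definition walk_return (n : nat) : R := iter n B (fun z => (z == 0)%:R) 0.

Lemma iter_coinD n (f h : int -> R) z :
  iter n B (fun y => f y + h y) z = iter n B f z + iter n B h z.
Proof. by elim: n z => //= n IHn z; rewrite !coinE !IHn; ring. Qed.

(** A fair step preserves the mean of [|z|] away from 0 and raises it by one at 0. *)
Lemma walk_absS n : walk_abs n.+1 = walk_abs n + walk_return n.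
Proof.
rewrite /walk_abs /walk_return iterSr -iter_coinD; congr (iter n B _ 0).
apply: funext => z; rewrite coinE.
apply: (@mulIf _ 2) => //; rewrite mulfVK//.
have [->|z0] := eqVneq z 0; first by rewrite add0r sub0r normrN normr1 normr0 add0r !mulr1z mul1r.
have -> : 2 = 2%:~R :> R by [].
by rewrite addr0 -intrM -intrD; congr (_%:~R); lia.
Qed.

(* Discrete Stein identity: E[S_n h(S_n)] = n E[(h(S_{n-1}+1) - h(S_{n-1}-1))/2]. *)
Lemma walk_stein n (h : int -> R) z :
  iter n.+1 B (fun y => y%:~R * h y) z =
  z%:~R * iter n.+1 B h z
  + n.+1%:R * iter n B (fun y => (h (y + 1) - h (y - 1)) / 2) z.
Proof.
elim: n h z => [|n IHn] h z.
  by rewrite /= !coinE !rmorphD/= rmorphN/=; field.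
rewrite iterSr.
have -> : B (fun y => y%:~R * h y) =
   (fun y => y%:~R * B h y + (h (y + 1) - h (y - 1)) / 2).
  by apply: funext => y; rewrite !coinE !rmorphD/= rmorphN/=; field.
rewrite iter_coinD IHn -iterSr -addrA; congr (_ + _).
rewrite -(natr1 n.+1) mulrDl mul1r; congr (_ * _ + _).
rewrite [in RHS]iterSr; congr (iter n B _ z).
by apply: funext => y; rewrite !coinE -!addrA ![_ + (_ - 1)]addrC; ring.
Qed.

(** The Stein identity with [h] the sign: its half-difference at [z] is the indicator of [z = 0]
    plus the probability of stepping from [z] to 0. *)
Lemma walk_abs_return n :
  walk_abs n.+1 = n.+1%:R * (walk_return n + walk_return n.+1).
Proof.
have -> : walk_abs n.+1 = iter n.+1 B (fun y => y%:~R * (Num.sg y)%:~R) 0.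
  congr (iter _ B _ 0); apply: funext => z.
  by rewrite -intrM mulrC -normrEsg.
rewrite walk_stein mul0r add0r; congr (_ * _).
rewrite /walk_return iterSr -iter_coinD; congr (iter n B _ 0).
apply: funext => z; rewrite coinE.
apply: (@mulIf _ 2) => //; rewrite mulfVK// mulrDl mulfVK//.
have [->|z0] := eqVneq z 0.
  by rewrite add0r sub0r sgrN sgr1 mulrNz /=; ring.
have [->|z1] := eqVneq z 1.
  by rewrite subrr sgr0 (_ : Num.sg (1 + 1) = 1 :> int)//=; ring.
have [->|z2] := eqVneq z (-1).
  by rewrite addNr sgr0 (_ : (Num.sg (-1 - 1))%:~R = -1 :> R)//=; ring.
have -> : z + 1 == 0 = false by lia.
have -> : z - 1 == 0 = false by lia.
have -> : Num.sg (z + 1) = Num.sg (z - 1) by lia.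
by rewrite /=; ring.
Qed.

Lemma walk_return0 : walk_return 0 = 1.
Proof. by []. Qed.

Lemma walk_return1 : walk_return 1 = 0.
Proof. by rewrite /walk_return /= coinE /=; ring. Qed.

(** The two preceding expressions of [walk_abs n.+2] are equated. *)
Lemma walk_returnSS n : n.+2%:R * walk_return n.+2 = n.+1%:R * walk_return n.
Proof.
have := walk_abs_return n.+1; rewrite walk_absS walk_abs_return.
by rewrite -!natr1; nra.
Qed.

(** Both sides obey the same two-step recurrence; the start values 1 and 0 produce the parity
    factor. *)
Lemma walk_return_wallis n : walk_return n = (~~ odd n)%:R * (2 / pi * wallis R n).
Proof.
elim/ltn_ind: n => -[_|[_|n IH]].
- by rewrite walk_return0 wallis0 mul1r mulrA divfK ?gt_eqF ?pi_gt0 ?divff.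
- by rewrite walk_return1 mul0r.
have n0 : n.+2%:R != 0 :> R by rewrite pnatr_eq0.
apply: (mulfI n0); rewrite walk_returnSS IH//= negbK.
rewrite !(mulrCA n.+2%:R) wallisSS; ring.
Qed.

(** Of two consecutive return probabilities only the even-time one is nonzero, and [wallis]
    decreases. *)
Lemma walk_abs_bounds n :
  n.+1%:R * (2 / pi * wallis R n.+1) <= walk_abs n.+1 <= n.+1%:R * (2 / pi * wallis R n).
Proof.
have pi0 : 0 <= 2 / pi :> R by rewrite divr_ge0 ?pi_ge0.
have w := ler_wpM2l pi0 (wallis_le R n).
rewrite walk_abs_return !ler_pM2l// !walk_return_wallis /=.
by case: (odd n); rewrite /= ?mul0r ?mul1r ?add0r ?addr0 lexx w.
Qed.

Lemma walk_abs_cvg :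
  (fun n => walk_abs n / Num.sqrt n%:R) @ \oo --> (Num.sqrt (2 / pi) : R).
Proof.
have pi0 : 0 < pi :> R := pi_gt0 R.
(* Squaring avoids roots in the bounds; the shift by two keeps [n + 1], a denominator of the upper
   bound, positive. *)
pose s n := walk_abs n.+2 ^+ 2 / n.+2%:R.
have s_bounds n : 2 / pi * (1 - harmonic n) <= s n <= 2 / pi * (1 + harmonic n).
  have n1 : 0 < n.+1%:R :> R by [].
  have /andP[] := walk_abs_bounds n.+1.
  have := wallis_gt0 R n.+1; have := wallis_gt0 R n.+2.
  have := wallis_sqr_le R n.+1; have := wallis_sqr_ge R n.+2.
  rewrite /s /harmonic /= -(natr1 n.+2) -(natr1 n.+1).
  (* Here [x] is [n + 1], [r] is [walk_abs n.+2], and [w'], [w] are the Wallis integrals at [n + 1]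
     and [n + 2]. *)
  move: (n.+1%:R) n1 (walk_abs _) (wallis _ _) (wallis _ _) => x x0 r w' w.
  rewrite -[pi / 2]invf_div.
  have c0 : 0 < 2 / pi :> R by rewrite divr_gt0.
  move: (2 / pi) c0 => c c0 lb ub w0 w'0 rl ru.
  have x1 : 0 < x + 1 by lra.
  have x2 : 0 < x + 1 + 1 by lra.
  have b0 : 0 <= (x + 1) * (c * w) by rewrite ltW// !mulr_gt0.
  have b'0 : 0 <= (x + 1) * (c * w') by rewrite ltW// !mulr_gt0.
  have r0 := le_trans b0 rl.
  have rl2 : ((x + 1) * (c * w)) ^+ 2 <= r ^+ 2.
    by rewrite lerXn2r.
  have ru2 : r ^+ 2 <= ((x + 1) * (c * w')) ^+ 2.
    by rewrite lerXn2r.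
  apply/andP; split.
  - rewrite ler_pdivlMr//; apply: le_trans rl2.
    have -> : ((x + 1) * (c * w)) ^+ 2 =
        (x + 1) ^+ 2 * c ^+ 2 / (x + 1 + 1) * ((x + 1 + 1) * w ^+ 2).
      by field; rewrite gt_eqF.
    have e0 : 0 <= (x + 1) ^+ 2 * c ^+ 2 / (x + 1 + 1).
      by rewrite ltW// divr_gt0// mulr_gt0// exprn_gt0.
    apply: le_trans (ler_wpM2l e0 lb).
    have -> : (x + 1) ^+ 2 * c ^+ 2 / (x + 1 + 1) * c^-1 =
       c * (1 - x^-1) * (x + 1) + 2 * c * (x + 1) / (x * (x + 1 + 1)).
      by field; rewrite !gt_eqF.
    by rewrite lerDl divr_ge0// ltW// !mulr_gt0.
  - rewrite ler_pdivrMr//; apply: le_trans ru2 _.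
    have -> : ((x + 1) * (c * w')) ^+ 2 = (x + 1) ^+ 2 * c ^+ 2 / x * (x * w' ^+ 2).
      by field; rewrite gt_eqF.
    have e0 : 0 <= (x + 1) ^+ 2 * c ^+ 2 / x.
      by rewrite ltW// divr_gt0// mulr_gt0// exprn_gt0.
    apply: le_trans (ler_wpM2l e0 ub) _.
    rewrite le_eqVlt; apply/orP; left; apply/eqP.
    by field; rewrite !gt_eqF.
have s_cvg : s @ \oo --> (2 / pi : R).
  apply: (@squeeze_cvgr _ _ _ _ (fun n => 2 / pi * (1 - harmonic n))
                              (fun n => 2 / pi * (1 + harmonic n))).
  - exact: nearW.
  - suff : (fun n => 2 / pi * (1 - harmonic n)) @ \oo --> (2 / pi * (1 - 0) : R).
      by rewrite subr0 mulr1.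
    by apply: cvgM; [exact: cvg_cst|apply: cvgB; [exact: cvg_cst|exact: cvg_harmonic]].
  - suff : (fun n => 2 / pi * (1 + harmonic n)) @ \oo --> (2 / pi * (1 + 0) : R).
      by rewrite addr0 mulr1.
    by apply: cvgM; [exact: cvg_cst|apply: cvgD; [exact: cvg_cst|exact: cvg_harmonic]].
rewrite -cvg_shiftS -cvg_shiftS /=.
have -> : (fun n => walk_abs n.+2 / Num.sqrt n.+2%:R) = Num.sqrt \o s.
  apply: funext => n; rewrite /s /= sqrtrM ?sqr_ge0// sqrtr_sqr sqrtrV//.
  rewrite ger0_norm// walk_abs_return mulr_ge0// !walk_return_wallis.
  by rewrite addr_ge0// mulr_ge0// mulr_ge0 ?divr_ge0 ?ltW// wallis_gt0.
exact: cvg_comp s_cvg (@sqrt_continuous _ _).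
Qed.

End rademacher.

(** * From samples to sums of independent scores *)

Section sampling.
Variable R : realType.

Lemma sum_ffun_ord_recl (T : finType) n (F : {ffun 'I_n.+1 -> T} -> R) :
  \sum_y F y =
  \sum_t \sum_(z : {ffun 'I_n -> T}) F [ffun i => oapp z t (unlift ord0 i)].
Proof.
rewrite pair_bigA /=.
rewrite (reindex (fun u : T * {ffun 'I_n -> T} =>
  [ffun i => oapp u.2 u.1 (unlift ord0 i)])) //=.
exists (fun y : {ffun 'I_n.+1 -> T} => (y ord0, [ffun i => y (lift ord0 i)])).
- move=> [t z] _ /=; rewrite ffunE unlift_none /=; congr (_, _).
  by apply/ffunP => i; rewrite !ffunE liftK.
- move=> y _; apply/ffunP => i; rewrite !ffunE /=.
  by case: unliftP => [j ->|->] /=; rewrite ?ffunE.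
Qed.

(** Induction on the sample size: the first draw is split off and its contribution moves into the
    starting point [v]. *)
Lemma iid_sum_avg (V : zmodType) (T : finType) (q : T -> R) (g : T -> V) (F : V -> R) n (v : V) :
  \sum_(y : {ffun 'I_n -> T}) (\prod_i q (y i)) * F (v + \sum_i g (y i)) =
  iter n (avg q g) F v.
Proof.
elim: n v => [|n IHn] v.
  rewrite (big_pred1 [ffun i : 'I_0 => match i with Ordinal _ h => False_rect T (notF h) end]).
    by rewrite !big_ord0 mul1r addr0.
  by move=> y; apply/esym/eqP/ffunP => -[].
rewrite sum_ffun_ord_recl iterS /avg; apply: eq_bigr => t _.
rewrite -IHn mulr_sumr; apply: eq_bigr => z _.
rewrite !big_ord_recl ffunE unlift_none /= -mulrA; congr (_ * (_ * F _)).
  by apply: eq_bigr => i _; rewrite ffunE liftK.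
by rewrite addrA; congr (_ + _); apply: eq_bigr => i _; rewrite ffunE liftK.
Qed.

Variables (K : nat) (p : 'rV[R]_K) (W : 'M[R]_K).

(** Summing out the hidden inputs factorizes over the samples: the outputs are i.i.d. with law
    [p *m W]. *)
Lemma expect_yE n (f : {ffun 'I_n -> 'I_K} -> R) :
  expect_y p W f =
  \sum_(y : {ffun 'I_n -> 'I_K}) (\prod_i (p *m W) 0 (y i)) * f y.
Proof.
rewrite /expect_y exchange_big; apply: eq_bigr => y _.
rewrite -mulr_suml; congr (_ * _).
under [RHS]eq_bigr do rewrite mxE.
by rewrite bigA_distr_bigA.
Qed.

Lemma expect_yD n (f h : {ffun 'I_n -> 'I_K} -> R) :
  expect_y p W (fun y => f y + h y) = expect_y p W f + expect_y p W h.
Proof. by rewrite !expect_yE -big_split; apply: eq_bigr => y _; rewrite mulrDr. Qed.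

Lemma expect_yZ n c (f : {ffun 'I_n -> 'I_K} -> R) :
  expect_y p W (fun y => c * f y) = c * expect_y p W f.
Proof. by rewrite !expect_yE mulr_sumr; apply: eq_bigr => y _; rewrite mulrCA. Qed.

Lemma expect_y_sum n (I : finType) (f : I -> {ffun 'I_n -> 'I_K} -> R) :
  expect_y p W (fun y => \sum_i f i y) = \sum_i expect_y p W (f i).
Proof.
under [RHS]eq_bigr do rewrite expect_yE.
rewrite expect_yE exchange_big; apply: eq_bigr => y _.
by rewrite mulr_sumr.
Qed.

Lemma ler_norm_expect_y n (f h : {ffun 'I_n -> 'I_K} -> R) :
  (forall l, 0 <= (p *m W) 0 l) -> (forall y, `|f y| <= h y) ->
  `|expect_y p W f| <= expect_y p W h.
Proof.
move=> q0 fh; rewrite !expect_yE; apply: le_trans (ler_norm_sum _ _ _) _.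
apply: ler_sum => y _; rewrite normrM ger0_norm ?prodr_ge0//.
by rewrite ler_wpM2l ?prodr_ge0.
Qed.

Lemma output_ge0 : prob_vec p -> row_stochastic W -> forall l, 0 <= (p *m W) 0 l.
Proof.
by move=> [p0 _] [W0 _] l; rewrite mxE sumr_ge0// => k _; rewrite mulr_ge0.
Qed.

Lemma output_sum1 : prob_vec p -> row_stochastic W -> \sum_l (p *m W) 0 l = 1.
Proof.
move=> [_ p1] [_ W1]; under eq_bigr do rewrite mxE.
by rewrite exchange_big /= -p1; apply: eq_bigr => k _; rewrite -mulr_sumr W1 mulr1.
Qed.

Hypothesis WU : W \in unitmx.
Hypothesis W1 : forall k, \sum_l W k l = 1.

(** [W] fixes the all-ones column, hence so does its inverse. *)
Lemma invmx_row_sum k : \sum_l invmx W k l = 1.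
Proof.
have e : W *m const_mx 1 = const_mx 1 :> 'cV[R]_K.
  apply/matrixP => i j; rewrite !mxE -[RHS](W1 i).
  by apply: eq_bigr => l _; rewrite mxE mulr1.
have : (invmx W *m (const_mx 1 : 'cV[R]_K)) k 0 = 1.
  by rewrite -{1}e mulKmx// mxE.
by rewrite mxE => <-; apply: eq_bigr => l _; rewrite mxE mulr1.
Qed.

Lemma check_pE n (y : {ffun 'I_n -> 'I_K}) k :
  check_p W y 0 k = (\sum_i invmx W (y i) k) / n%:R.
Proof.
rewrite /check_p /emp_dist mxE mulr_suml.
rewrite (partition_big y xpredT) //=; apply: eq_bigr => l _; rewrite mxE.
rewrite (eq_bigr (fun=> invmx W l k / n%:R)); last by move=> i /eqP ->.
rewrite sumr_const -cardsE -mulr_natl; ring.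
Qed.

(** Stated for a nonempty sample: at size 0 the empirical frequencies are [0 / 0 = 0]. *)
Lemma check_p_sum n (y : {ffun 'I_n.+1 -> 'I_K}) : \sum_k check_p W y 0 k = 1.
Proof.
under eq_bigr do rewrite check_pE.
rewrite -mulr_suml exchange_big /=; under eq_bigr do rewrite invmx_row_sum.
by rewrite sumr_const card_ord divff ?pnatr_eq0.
Qed.

(** The centred contribution of one observation [l] to coordinate [k] of the estimator. *)
Definition score k l : R := invmx W l k - p 0 k.

Lemma check_p_score n (y : {ffun 'I_n.+1 -> 'I_K}) k :
  check_p W y 0 k - p 0 k = (\sum_i score k (y i)) / n.+1%:R.
Proof.
by rewrite check_pE /score sumrB sumr_const card_ord -(mulr_natr (p 0 k)) mulrBl mulfK ?pnatr_eq0.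
Qed.

Lemma nu1E k : nu 1 p W k = p 0 k.
Proof.
rewrite /nu (_ : hadamard_pow 1 _ = invmx W) ?mulmxK//.
by apply/matrixP => i j; rewrite mxE.
Qed.

Lemma score_mean k : \sum_l (p *m W) 0 l = 1 ->
  \sum_l (p *m W) 0 l * score k l = 0.
Proof.
move=> q1; under eq_bigr do rewrite mulrBr.
rewrite sumrB -mulr_suml q1 mul1r; apply/eqP; rewrite subr_eq0; apply/eqP.
by rewrite -[in RHS](mulmxK WU p) [RHS]mxE.
Qed.

Lemma score_var k : \sum_l (p *m W) 0 l = 1 ->
  \sum_l (p *m W) 0 l * score k l ^+ 2 = nu 2 p W k - nu 1 p W k ^+ 2.
Proof.
move=> q1; have := score_mean k q1; rewrite nu1E {2}/score.
under eq_bigr do rewrite mulrBr.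
rewrite sumrB -mulr_suml q1 mul1r => /eqP; rewrite subr_eq0 => /eqP m.
rewrite /nu mxE.
have -> : \sum_l (p *m W) 0 l * score k l ^+ 2 =
   \sum_l ((p *m W) 0 l * invmx W l k ^+ 2 - 2 * p 0 k * ((p *m W) 0 l * invmx W l k)
     + (p *m W) 0 l * p 0 k ^+ 2).
  by apply: eq_bigr => l _; rewrite /score; ring.
rewrite big_split sumrB /= -mulr_sumr -mulr_suml q1 m.
have -> : \sum_j (p *m W) 0 j * hadamard_pow 2 (invmx W) j k =
   \sum_j (p *m W) 0 j * invmx W j k ^+ 2.
  by apply: eq_bigr => j _; rewrite [hadamard_pow _ _ _ _]mxE.
ring.
Qed.

End sampling.

(** * Mean absolute value of a centred i.i.d. sum *)

Section clt.
Variable R : realType.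

Lemma cvg0_norm_le (r h : nat -> R) :
  (forall n, `|r n| <= h n) -> h @ \oo --> (0 : R) -> r @ \oo --> (0 : R).
Proof.
move=> rh h0; apply: (@squeeze_cvgr _ _ _ _ (fun n => - h n) h) => //.
  by apply: nearW => n; rewrite -ler_norml.
by rewrite -oppr0; apply: cvgN.
Qed.

Lemma cvg_sqrt0 (h : nat -> R) :
  h @ \oo --> (0 : R) -> (fun n => Num.sqrt (h n)) @ \oo --> (0 : R).
Proof.
by move=> h0; rewrite -sqrtr0; exact: cvg_comp h0 (@sqrt_continuous _ _).
Qed.

(** A walk with steps [s] and [- s] stays on the multiples of [s], so it is the integer walk
    rescaled. *)
Lemma iter_coin_abs (s : R) n : 0 <= s ->
  iter n (coin s) Num.norm 0 = s * walk_abs R n.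
Proof.
move=> s0; have scale z : iter n (coin s) Num.norm (s * z%:~R) =
    s * iter n (@coin R int 1) (fun z => `|z|%:~R) z.
  elim: n z => [|n IHn] z; first by rewrite /= normrM ger0_norm// intr_norm.
  rewrite !iterS !coinE.
  have -> : s * z%:~R + s = s * (z + 1)%:~R by rewrite rmorphD/=; ring.
  have -> : s * z%:~R - s = s * (z - 1)%:~R by rewrite rmorphB/=; ring.
  by rewrite !IHn; ring.
by have := scale 0; rewrite mulr0z mulr0.
Qed.

Variables (I : finType) (q g : I -> R).
Hypotheses (q0 : forall i, 0 <= q i) (q1 : \sum_i q i = 1).
Hypothesis qg : \sum_i q i * g i = 0.

Let A := avg q g.
Let sigma : R := Num.sqrt (\sum_i q i * g i ^+ 2).
(** A common bound for the steps [g i] and the coin steps [sigma]; the added 1 makes it positive. *)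
Let M : R := sigma + \sum_i `|g i| + 1.

Lemma iter_avg_sqr n x :
  iter n A (fun x => x ^+ 2) x = x ^+ 2 + n%:R * \sum_i q i * g i ^+ 2.
Proof.
elim: n x => [|n IHn] x; first by rewrite mul0r addr0.
rewrite iterS /A /avg -/A; under eq_bigr do rewrite IHn.
rewrite -natr1; set v := \sum_i q i * _ ^+ 2.
have -> : \sum_i q i * ((x + g i) ^+ 2 + n%:R * v) =
    \sum_i (q i * (x ^+ 2 + n%:R * v) + 2 * x * (q i * g i) + q i * g i ^+ 2).
  by apply: eq_bigr => i _; ring.
by rewrite !big_split /= -mulr_suml -mulr_sumr q1 qg -/v; ring.
Qed.

(** Smoothing costs [D] for each walk, and each of the [n] replacements costs two Taylor errors
    [2 M^3 / D^2]. *)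
Lemma lindeberg_abs n D : M <= D ->
  `|iter n A Num.norm 0 - sigma * walk_abs R n| <= 2 * D + n%:R * (4 * M ^+ 3 / D ^+ 2).
Proof.
move=> MD.
have s0 : 0 <= sigma := sqrtr_ge0 _.
have sg0 : 0 <= \sum_i `|g i| by apply: sumr_ge0.
have M1 : 1 <= M by rewrite /M; lra.
have D0 : 0 < D by lra.
rewrite -iter_coin_abs//.
have h1 : \sum_(b : bool) 2^-1 = 1 :> R by rewrite big_bool /=; field.
have hg : \sum_(b : bool) 2^-1 * (if b then sigma else - sigma) = 0.
  by rewrite big_bool /=; ring.
have hM (b : bool) : `|if b then sigma else - sigma| <= M.
  by case: b; rewrite ?normrN ger0_norm// /M; lra.
have gM i : `|g i| <= M.
  rewrite /M (bigD1 i) //=.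
  have : 0 <= \sum_(j | j != i) `|g j| by apply: sumr_ge0.
  lra.
have h0 (b : bool) : 0 <= 2^-1 :> R by [].
set f := smooth_abs D.
have near : forall x, `| `|x| - f x| <= D by move=> x; exact/smooth_abs_near/ltW.
have d1 : `|iter n A Num.norm 0 - iter n A f 0| <= D :=
  iter_avg_near g q0 q1 n near 0.
have d2 : `|iter n (coin sigma) Num.norm 0 - iter n (coin sigma) f 0| <= D :=
  iter_avg_near (fun b => if b then sigma else - sigma) h0 h1 n near 0.
(* The coin has variance [sigma^2], so both one-step averages have the same expansion [T]. *)
have step x : `|A f x - coin sigma f x| <= 4 * M ^+ 3 / D ^+ 2.
  have t1 := smooth_avg_taylor q0 q1 qg D0 MD gM x.
  have t2 := smooth_avg_taylor h0 h1 hg D0 MD hM x.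
  move: t1 t2; rewrite /= -/f -/A.
  have -> : \sum_(b : bool) 2^-1 * (if b then sigma else - sigma) ^+ 2 = sigma ^+ 2.
    by rewrite big_bool /=; field.
  rewrite sqr_sqrtr; last by apply: sumr_ge0 => i _; rewrite mulr_ge0 ?sqr_ge0.
  set T := f x + _ => t1 t2.
  have -> : 4 * M ^+ 3 / D ^+ 2 = 2 * M ^+ 3 / D ^+ 2 + 2 * M ^+ 3 / D ^+ 2 by ring.
  apply: le_trans (ler_distD T _ _) _; rewrite lerD//.
  by rewrite distrC.
have d3 : `|iter n A f 0 - iter n (coin sigma) f 0| <= n%:R * (4 * M ^+ 3 / D ^+ 2) :=
  lindeberg n q0 q1 h0 h1 step 0.
clear h0; rewrite distrC in d2.
apply: le_trans (ler_distD (iter n A f 0) _ _) _.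
apply: le_trans (lerD d1 (ler_distD (iter n (coin sigma) f 0) _ _)) _.
apply: le_trans (lerD (lexx D) (lerD d3 d2)) _.
by rewrite (addrC _ D) addrA -mulr2n -(mulr_natl D).
Qed.

Lemma abs_sum_cvg :
  (fun n => iter n A Num.norm 0 / Num.sqrt n%:R) @ \oo --> (Num.sqrt (2 / pi) * sigma : R).
Proof.
(* This is [(n + 1)^(-1/8)]. The errors [D] and [n / D^2] are both negligible against [sqrt n] when
   [D] lies strictly between the orders [n^(1/4)] and [n^(1/2)]; [D = M / u^3], of order [n^(3/8)],
   is midway. *)
pose u n : R := Num.sqrt (Num.sqrt (Num.sqrt (harmonic n))).
have u_cvg : u @ \oo --> (0 : R) by do 3!apply: cvg_sqrt0; exact: cvg_harmonic.
have -> : (fun n => iter n A Num.norm 0 / Num.sqrt n%:R) =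
  (fun n => (iter n A Num.norm 0 - sigma * walk_abs R n) / Num.sqrt n%:R
          + walk_abs R n / Num.sqrt n%:R * sigma).
  by apply: funext => n; ring.
rewrite -[X in _ --> X]add0r; apply: cvgD; last first.
  by apply: cvgM; [exact: walk_abs_cvg|exact: cvg_cst].
rewrite -cvg_shiftS.
(* After division by [sqrt (n + 1)] the errors are [2 M u] and [4 M u^2], and [u <= 1]. *)
apply: (@cvg0_norm_le _ (fun n => 6 * M * u n)); last first.
  by rewrite -(mulr0 (6 * M)); apply: cvgM => //; exact: cvg_cst.
move=> n /=.
have u0 : 0 < u n by rewrite !sqrtr_gt0 invr_gt0.
have u4 : (u n) ^+ 4 = (Num.sqrt n.+1%:R)^-1.
  rewrite (exprM _ 2 2) !sqr_sqrtr ?sqrtr_ge0// /harmonic /=.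
  by rewrite sqrtrV.
have u8 : n.+1%:R = (u n ^+ 8)^-1.
  rewrite (exprM _ 4 2) u4 -exprVn invrK sqr_sqrtr//.
have sqrt_le1 (x : R) : x <= 1 -> Num.sqrt x <= 1.
  by move=> x1; rewrite -[leRHS]sqrtr1 ler_wsqrtr.
have u1 : u n <= 1.
  by apply/sqrt_le1/sqrt_le1/sqrt_le1; rewrite /harmonic /= invf_le1// ler1n.
have M0 : 0 < M.
  have s0 : 0 <= sigma := sqrtr_ge0 _.
  have sg0 : 0 <= \sum_i `|g i| by apply: sumr_ge0.
  by rewrite /M; lra.
have MD : M <= M / u n ^+ 3.
  by rewrite ler_pdivlMr ?exprn_gt0// ler_piMr ?(ltW M0)// exprn_ile1// ltW.
rewrite normrM -u4 (ger0_norm (exprn_ge0 _ (ltW u0))).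
apply: le_trans (ler_wpM2r (exprn_ge0 _ (ltW u0)) (lindeberg_abs n.+1 MD)) _.
rewrite u8; move: (u n) u0 u1 => x x0 x1.
have -> : (2 * (M / x ^+ 3) + (x ^+ 8)^-1 * (4 * M ^+ 3 / (M / x ^+ 3) ^+ 2)) * x ^+ 4
   = 2 * M * x + 4 * M * x * x.
  by field; rewrite !gt_eqF.
have : 0 <= M * x * (1 - x) by rewrite mulr_ge0 ?subr_ge0// ltW// mulr_gt0.
by move: M => m; nra.
Qed.

End clt.

(* [Proj v] differs from [v] only if some entry of [v] is negative, and then
   [(v_k - p_k)^2 / p_k^2 >= 1] for that entry. *)
Lemma l1norm_Proj_near (R : realType) (K : nat) (p : 'rV[R]_K)
    (Proj : 'rV[R]_K -> 'rV[R]_K) (v : 'rV[R]_K) :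
  prob_vec p -> (forall k, 0 < p 0 k) ->
  (forall v : 'rV[R]_K, \sum_k v 0 k = 1 -> prob_vec (Proj v)) ->
  (forall v : 'rV[R]_K, prob_vec v -> Proj v = v) ->
  \sum_k v 0 k = 1 ->
  `|l1norm (Proj v - p) - l1norm (v - p)| <=
    (K%:R + 2) * \sum_k (p 0 k ^+ 2)^-1 * (v 0 k - p 0 k) ^+ 2.
Proof.
move=> [_ psum] ppos HProj HProjid vsum.
pose t k := (p 0 k ^+ 2)^-1 * (v 0 k - p 0 k) ^+ 2.
rewrite -/(\sum_k t k); set Q := \sum_k t k.
have t0 k : 0 <= t k by rewrite mulr_ge0 ?invr_ge0 ?sqr_ge0.
have Q0 : 0 <= Q by apply: sumr_ge0.
have [v0|] := pselect (forall k, 0 <= v 0 k).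
  by rewrite HProjid// subrr normr0 mulr_ge0// addr_ge0.
move=> /existsNP[k0 /negP]; rewrite -ltNge => vk0.
have Q1 : 1 <= Q.
  rewrite /Q (bigD1 k0)//=; apply: (@le_trans _ _ (t k0)); last first.
    by rewrite lerDl sumr_ge0.
  rewrite /t mulrC ler_pdivlMr ?exprn_gt0// mul1r.
  by have := ppos k0; nra.
have p1 k : p 0 k <= 1.
  by rewrite -psum (bigD1 k)//= lerDl sumr_ge0// => i _; rewrite ltW.
have [w0 wsum] := HProj v vsum.
have a0 : 0 <= l1norm (Proj v - p) by apply: sumr_ge0.
have b0 : 0 <= l1norm (v - p) by apply: sumr_ge0.
have a2 : l1norm (Proj v - p) <= 2.
  have -> : 2 = \sum_k (Proj v 0 k + p 0 k) :> R by rewrite big_split /= wsum psum.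
  apply: ler_sum => k _; rewrite !mxE; apply: le_trans (ler_normB _ _) _.
  by rewrite !ger0_norm// ltW.
(* Each term satisfies [|d| <= 1 + d^2], and [d^2 <= t k] because [p_k <= 1]. *)
have bQ : l1norm (v - p) <= K%:R + Q.
  have -> : K%:R + Q = \sum_k (1 + t k).
    by rewrite big_split /= sumr_const card_ord.
  apply: ler_sum => k _; rewrite !mxE.
  have : `|v 0 k - p 0 k| ^+ 2 <= t k.
    rewrite real_normK ?num_real// /t ler_peMl ?sqr_ge0//.
    by rewrite invf_ge1 ?exprn_gt0// exprn_ile1// ltW.
  have := normr_ge0 (v 0 k - p 0 k); nra.
have K0 : 0 <= K%:R :> R by [].
have KQ : K%:R <= K%:R * Q by rewrite ler_peMr.
rewrite mulrDl ler_norml; apply/andP; split; lra.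
Qed.

(** * Assembly of the expansion *)

Unset Implicit Arguments.
Set Strict Implicit.

Theorem theorem4 (R : realType) (K : nat) (HK : (2 <= K)%N)
  (p : 'rV[R]_K) (W : 'M[R]_K)
  (Hp : prob_vec p) (Hppos : forall k, 0 < p 0 k)
  (HW : row_stochastic W) (HWinv : W \in unitmx)
  (Proj : 'rV[R]_K -> 'rV[R]_K)
  (HProj : forall v : 'rV[R]_K, \sum_k v 0 k = 1 -> prob_vec (Proj v))
  (HProjid : forall v : 'rV[R]_K, prob_vec v -> Proj v = v) :
  (fun n : nat =>
     Num.sqrt (n%:R : R) *
     (expect_y p W (fun y : {ffun 'I_n -> 'I_K} => l1norm (Proj (check_p W y) - p))
      - Num.sqrt (2 / (pi * n%:R)) *
          \sum_k Num.sqrt (nu 2 p W k - nu 1 p W k ^+ 2)))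
  @ \oo --> (0 : R).
Proof.
pose q l := (p *m W) 0 l; pose g := score p W.
have q0 : forall l, 0 <= q l := output_ge0 Hp HW.
have q1 : \sum_l q l = 1 := output_sum1 Hp HW.
have W1 := HW.2.
have qg k : \sum_l q l * g k l = 0 := score_mean HWinv k q1.
have qgg k : \sum_l q l * g k l ^+ 2 = nu 2 p W k - nu 1 p W k ^+ 2 :=
  score_var HWinv k q1.
pose S n k := iter n (avg q (g k)) Num.norm 0.
have expect_F n k (F : R -> R) :
    expect_y p W (fun y : {ffun 'I_n -> 'I_K} => F (\sum_i g k (y i))) =
    iter n (avg q (g k)) F 0.
  rewrite expect_yE -iid_sum_avg; apply: eq_bigr => y _.
  by rewrite add0r.
(* The expected bound of [l1norm_Proj_near] is [C / (n + 1)], since coordinate [k] has variance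
   [(nu_2 - nu_1^2) / (n + 1)]. *)
pose C := (K%:R + 2) * \sum_k (p 0 k ^+ 2)^-1 * (nu 2 p W k - nu 1 p W k ^+ 2).
have expect_near n :
    `|expect_y p W (fun y : {ffun 'I_n.+1 -> 'I_K} => l1norm (Proj (check_p W y) - p))
      - (\sum_k S n.+1 k) / n.+1%:R| <= C / n.+1%:R.
  (* The l1 norm splits over coordinates, so only one-dimensional sums occur. *)
  have -> : (\sum_k S n.+1 k) / n.+1%:R =
      expect_y p W (fun y : {ffun 'I_n.+1 -> 'I_K} => l1norm (check_p W y - p)).
    rewrite expect_y_sum mulr_suml; apply: eq_bigr => k _.
    rewrite /S -expect_F mulrC -expect_yZ; congr expect_y.
    apply: funext => y; rewrite [in RHS]mxE [X in _ + X]mxE check_p_score//.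
    by rewrite normrM mulrC normfV normr_nat.
  rewrite -[X in _ - X]mul1r -mulNr -expect_yZ -expect_yD.
  apply: le_trans (ler_norm_expect_y (h := fun y => (K%:R + 2) *
    \sum_k (p 0 k ^+ 2)^-1 * (check_p W y 0 k - p 0 k) ^+ 2) q0 _) _.
    move=> y; rewrite mulN1r; apply: l1norm_Proj_near => //.
    exact: check_p_sum.
  rewrite expect_yZ /C -mulrA ler_wpM2l ?addr_ge0// expect_y_sum mulr_suml.
  apply: ler_sum => k _; rewrite expect_yZ -mulrA ler_wpM2l ?invr_ge0 ?sqr_ge0//.
  rewrite le_eqVlt; apply/orP; left; apply/eqP.
  have -> : (fun y : {ffun 'I_n.+1 -> 'I_K} => (check_p W y 0 k - p 0 k) ^+ 2) =
      (fun y => n.+1%:R ^- 2 * (\sum_i g k (y i)) ^+ 2).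
    by apply: funext => y; rewrite check_p_score// exprMn exprVn mulrC.
  rewrite expect_yZ (expect_F _ _ (fun x => x ^+ 2)) iter_avg_sqr// qgg.
  by rewrite expr0n add0r; field; rewrite nat1r pnatr_eq0.
pose L k := Num.sqrt (2 / pi) * Num.sqrt (\sum_l q l * g k l ^+ 2) : R.
have S_cvg k : (fun n => S n.+1 k / Num.sqrt n.+1%:R) @ \oo --> L k.
  by rewrite (cvg_shiftS (fun n => S n k / Num.sqrt n%:R)); exact: abs_sum_cvg.
(* Passing to sizes [n + 1] discards the empty sample. *)
rewrite -cvg_shiftS.
pose E n := expect_y p W (fun y : {ffun 'I_n.+1 -> 'I_K} => l1norm (Proj (check_p W y) - p)).
(* The scaled error splits into the effect of the projection and, for each coordinate, the gap to
   its limit [L k]. *)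
have -> : (fun n => Num.sqrt n.+1%:R * (E n - Num.sqrt (2 / (pi * n.+1%:R)) *
          \sum_k Num.sqrt (nu 2 p W k - nu 1 p W k ^+ 2))) =
  (fun n => Num.sqrt n.+1%:R * (E n - (\sum_k S n.+1 k) / n.+1%:R)
     + \sum_k (S n.+1 k / Num.sqrt n.+1%:R - L k)).
  apply: funext => n.
  have s0 : Num.sqrt n.+1%:R != 0 :> R by rewrite gt_eqF ?sqrtr_gt0.
  have -> : Num.sqrt (2 / (pi * n.+1%:R)) = Num.sqrt (2 / pi) / Num.sqrt n.+1%:R :> R.
    by rewrite invfM mulrA sqrtrM ?divr_ge0 ?pi_ge0// sqrtrV.
  have -> : n.+1%:R = Num.sqrt n.+1%:R ^+ 2 :> R by rewrite sqr_sqrtr.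
  rewrite sqrtr_sqr ger0_norm ?sqrtr_ge0//.
  rewrite sumrB -mulr_suml -mulr_sumr.
  have -> : \sum_k Num.sqrt (\sum_l q l * g k l ^+ 2) =
      \sum_k Num.sqrt (nu 2 p W k - nu 1 p W k ^+ 2).
    by apply: eq_bigr => k _; rewrite qgg.
  by field.
have proj_cvg : (fun n => Num.sqrt n.+1%:R * (E n - (\sum_k S n.+1 k) / n.+1%:R))
    @ \oo --> (0 : R).
  apply: (@cvg0_norm_le _ _ (fun n => C * Num.sqrt (harmonic n))); last first.
    rewrite -(mulr0 C); apply: cvgM; first exact: cvg_cst.
    by apply: cvg_sqrt0; exact: cvg_harmonic.
  move=> n; rewrite normrM ger0_norm ?sqrtr_ge0//.
  apply: le_trans (ler_wpM2l (sqrtr_ge0 _) (expect_near n)) _.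
  rewrite le_eqVlt; apply/orP; left; apply/eqP.
  have s0 : Num.sqrt n.+1%:R != 0 :> R by rewrite gt_eqF ?sqrtr_gt0.
  rewrite /harmonic /= sqrtrV// -{2}[n.+1%:R]sqr_sqrtr//.
  by field.
have sum_cvg : (fun n => \sum_k (S n.+1 k / Num.sqrt n.+1%:R - L k)) @ \oo -->
    \sum_k (L k - L k).
  apply: (@cvg_big R^o _ +%R 0 xpredT) => [|k _]; first exact: add_continuous.
  by apply: cvgB; [exact: S_cvg|exact: cvg_cst].
have L0 : \sum_k (L k - L k) = 0 by apply: big1 => k _; rewrite subrr.
have := cvgD proj_cvg sum_cvg; rewrite L0 addr0; exact.
Qed.
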